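(* Let $\zeta$ be a random variable with the standard exponential distribution, i.e. $\mathrm{Prob}(\zeta\in[\alpha,\beta])=\int_\alpha^\beta e^{-t}\,dt$ for $[\alpha,\beta]\subset[0,\infty)$. There is no (real) base $B>1$ such that $\zeta$ is Benford base $B$.
   Context: For real $B>1$ and $x>0$ write uniquely $x=M_B(x)B^k$ with $k\in\mathbb{Z}$ and $M_B(x)\in[1,B)$ (the mantissa). A positive random variable $\zeta$ is Benford base $B$ if $\mathrm{Prob}(1\le M_B(\zeta)\le s)=\log_B s$ for all $s\in[1,B]$; equivalently, $\log_B\zeta \bmod 1$ is uniformly distributed on $[0,1]$. *)

(* Defs.v *)
From HB Require Import structures.
From mathcomp Require Import all_boot all_order all_algebra.
From mathcomp Require Import all_classical all_reals all_analysis.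
Set Implicit Arguments.
Unset Strict Implicit.
Unset Printing Implicit Defensive.
Import Order.TTheory GRing.Theory Num.Theory.
Import numFieldNormedType.Exports.
Local Open Scope classical_set_scope.
Local Open Scope ring_scope.

Definition is_mantissa (R : realType) (B x m : R) : Prop :=
  1 <= m < B /\ exists k : int, x = m * B ^ k.

(* For B > 1, the unique m satisfying [is_mantissa B x m] if x > 0
   (see [mantissaP]), and 0, which is outside [1, B), if x <= 0. *)
Definition mantissa (R : realType) (B x : R) : R :=
  xget 0 [set m | is_mantissa B x m].

Definition log_base (R : realType) (B s : R) : R := ln s / ln B.

(* Positivity of X is not a separate conjunct: the case s = B forces
   0 < X almost surely, since [mantissa B x] = 0 for x <= 0. *)
Definition benford (R : realType) (d : measure_display) (T : measurableType d)
    (P : probability T R) (B : R) (X : {RV P >-> R}) : Prop :=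
  forall s : R, 1 <= s <= B ->
    P [set t | 1 <= mantissa B (X t) <= s] = (log_base B s)%:E.

Definition standard_exponential (R : realType) (d : measure_display)
    (T : measurableType d) (P : probability T R) (X : {RV P >-> R}) : Prop :=
  forall a b : R, 0 <= a -> a <= b ->
    P [set t | a <= X t <= b] =
    (\int[lebesgue_measure]_(t in `[a, b]) (expR (- t))%:E)%E.

Lemma is_mantissa_uniq (R : realType) (B x m n : R) : 1 < B ->
  is_mantissa B x m -> is_mantissa B x n -> m = n.
Proof.
move=> B1 [/andP[m1 mB] [k xk]] [/andP[n1 nB] [l xl]].
have B0 : 0 < B by apply: lt_trans B1.
have step (u v : R) (i j : int) : 1 <= v -> u < B ->
    u * B ^ i = v * B ^ j -> j <= i.
  move=> v1 uB e; rewrite leNgt; apply/negP => ij.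
  suff : u * B ^ i < v * B ^ j by rewrite e ltxx.
  have Bi : 0 < B ^ i by rewrite exprz_gt0.
  have Bj : 0 < B ^ j by rewrite exprz_gt0.
  have h1 : u * B ^ i < B * B ^ i by rewrite ltr_pM2r.
  apply: (lt_le_trans h1).
  have -> : B * B ^ i = B ^ (1 + i) by rewrite expfzDr ?expr1z // gt_eqF.
  have h2 : B ^ (1 + i) <= B ^ j.
    by rewrite ler_eXz2l // lez1D.
  by apply: (le_trans h2); rewrite ler_peMl // ltW.
have ekl : k = l.
  have e : m * B ^ k = n * B ^ l by rewrite -xk -xl.
  by apply/eqP; rewrite eq_le (step _ _ _ _ m1 nB (esym e)) (step _ _ _ _ n1 mB e).
have := xk; rewrite xl ekl => /(mulIf _) -> //.
by rewrite expfz_neq0 // gt_eqF.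
Qed.

Lemma is_mantissa_ex (R : realType) (B x : R) : 1 < B -> 0 < x ->
  is_mantissa B x (x * B ^ (- Num.floor (log_base B x))).
Proof.
move=> B1 x0; have B0 : 0 < B by apply: lt_trans B1.
have Bn0 : B != 0 by rewrite gt_eqF.
set k := Num.floor _.
have lB : 0 < ln B by rewrite ln_gt0.
have Bz (i : int) : B ^ i = expR (i%:~R * ln B).
  by rewrite -powR_intmul ?ltW // /powR (negbTE Bn0).
have ex : x = expR (ln x) by rewrite lnK.
have /andP[k1 k2] := floor_itv (log_base B x).
rewrite -/k in k1 k2; split; last first.
  by exists k; rewrite -mulrA -expfzDr // addNr expr0z mulr1.
have -> : x * B ^ (- k) = expR (log_base B x * ln B - k%:~R * ln B).
  by rewrite Bz rmorphN /= mulNr {1}ex -expRD /log_base divfK // gt_eqF.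
rewrite -mulrBl; apply/andP; split.
  rewrite -[leLHS]expR0 ler_expR; apply: mulr_ge0; last exact: ltW.
  by rewrite subr_ge0.
rewrite -[ltRHS]lnK // ltr_expR -[ltRHS]mul1r ltr_pM2r // ltrBlDr.
by rewrite addrC -(intrD _ k 1).
Qed.

Lemma mantissaP (R : realType) (B x m : R) : 1 < B -> 0 < x ->
  is_mantissa B x m <-> m = mantissa B x.
Proof.
move=> B1 x0.
have h : is_mantissa B x (mantissa B x).
  exact: (xgetPex 0 (ex_intro _ _ (is_mantissa_ex B1 x0))).
by split=> [hm|->//]; apply: is_mantissa_uniq hm h.
Qed.

Lemma mantissa_le0 (R : realType) (B x : R) : 1 < B -> x <= 0 ->
  mantissa B x = 0.
Proof.
move=> B1 x0; apply: xgetPN => m [/andP[m1 _] [k e]].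
have B0 : 0 < B by apply: lt_trans B1.
by move: x0; rewrite e leNgt mulr_gt0 ?exprz_gt0 // (lt_le_trans _ m1).
Qed.

(* Main.v *)
(* If zeta is Benford base B, then, for F(s) := P(M_B(zeta) <= s), summing over
   the exponent k of zeta shows that
     F(s) = sum_k (e^(- B^k) - e^(- s B^k)) = log_B s  for s in [1, B),
   and, by telescoping, for all s > 0. The backward difference
   f(x) - f(x + h), iterated n times, multiplies e^(- s b) by
   (1 - e^(- h b))^n, so the term k = 0 alone bounds the n-th difference of - F
   from below by e^(- s) (1 - e^(- h))^n, whereas the n-th difference of
   - log_B at s is at most (n - 1)! (h / s)^n / ln B by the mean value theorem.
   At s = n and h = 1 / n this bounds n^n e^(- n) / (n - 1)! uniformly in n, but
   this quantity is of order sqrt n. *)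
Require Import Defs.
From HB Require Import structures.
From mathcomp Require Import all_boot all_order all_algebra.
From mathcomp Require Import all_classical all_reals all_analysis.
From mathcomp Require Import zify ring lra.
Import Order.TTheory GRing.Theory Num.Theory.
Import numFieldNormedType.Exports.
Local Open Scope classical_set_scope.
Local Open Scope ring_scope.

Set Implicit Arguments.
Unset Strict Implicit.
Unset Printing Implicit Defensive.

(** * Iterated backward differences *)

Definition bdiff (R : realType) (h : R) (f : R -> R) (x : R) : R :=
  f x - f (x + h).

Lemma iter_bdiff_sum (R : realType) (h : R) (n m : nat) (f : 'I_m -> R -> R)
    (x : R) :
  iter n (bdiff h) (fun y => \sum_(i < m) f i y) x =
  \sum_(i < m) iter n (bdiff h) (f i) x.
Proof.
elim: n x => [//|n IHn] x.
rewrite iterS /bdiff -/(bdiff h) !IHn -sumrB.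
by apply: eq_bigr => i _; rewrite iterS.
Qed.

(** Exponentials are eigenfunctions of [bdiff h]; the sign chosen in [bdiff] makes the eigenvalue
    nonnegative for h, b >= 0. The first difference kills the constant [c], hence [n.+1]. *)
Lemma iter_bdiff_expR (R : realType) (h b c : R) (n : nat) (x : R) :
  iter n.+1 (bdiff h) (fun y => expR (- (y * b)) - c) x =
  expR (- (x * b)) * (1 - expR (- (h * b))) ^+ n.+1.
Proof.
have eD (y : R) : expR (- ((y + h) * b)) = expR (- (y * b)) * expR (- (h * b)).
  by rewrite -expRD -opprD -mulrDl.
elim: n x => [|n IHn] x; first by rewrite /= /bdiff eD; ring.
rewrite iterS /bdiff -/(bdiff h) !IHn eD.
by rewrite [in RHS]exprS; ring.
Qed.

(** An iterated difference is a finite combination of values at x, x + h, ..., x + n h, all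
    positive, so pointwise limits pass through. *)
Lemma cvg_iter_bdiff (R : realType) (h : R) (f : nat -> R -> R) (g : R -> R)
    (n : nat) (x : R) : 0 <= h -> 0 < x ->
  (forall y, 0 < y -> f N y @[N --> \oo] --> g y) ->
  iter n (bdiff h) (f N) x @[N --> \oo] --> iter n (bdiff h) g x.
Proof.
move=> h0 x0 fg; elim: n x x0 => [|n IHn] x x0; first exact: fg.
by apply: cvgB; apply: IHn; rewrite ?ltr_wpDr.
Qed.

Lemma is_derive_iter_bdiff (R : realType) (h : R) (f g : R -> R) (n : nat)
    (x : R) : 0 <= h -> 0 < x ->
  (forall y : R, 0 < y -> is_derive y 1 f (- g y)) ->
  is_derive x 1 (iter n (bdiff h) f) (- iter n (bdiff h) g x).
Proof.
move=> h0 x0 fg; elim: n x x0 => [|n IHn] x x0; first exact: fg.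
have d1 := IHn _ x0.
have d2 : is_derive x 1 (iter n (bdiff h) f \o +%R^~ h)
    (- iter n (bdiff h) g (x + h)).
  have d3 : is_derive (x + h) 1 (iter n (bdiff h) f) _ :=
    IHn (x + h) (ltr_wpDr h0 x0).
  have d4 : is_derive x 1 (+%R^~ h : R -> R) 1.
    by apply: is_derive_eq; rewrite addr0.
  by rewrite -[X in is_derive _ _ _ X]mulr1; exact: is_derive1_comp.
have := is_deriveB d1 d2.
by rewrite iterS /bdiff -opprD.
Qed.

(** One of the n + 1 differences is traded for a factor h and a derivative. Of the location of [c]
    only x < c is kept: the bounds applied at [c] decrease. *)
Lemma iter_bdiff_MVT (R : realType) (h : R) (f g : R -> R) (n : nat) (x : R) :
  0 < h -> 0 < x ->
  (forall y : R, 0 < y -> is_derive y 1 f (- g y)) ->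
  exists2 c, x < c & iter n.+1 (bdiff h) f x = h * iter n (bdiff h) g c.
Proof.
move=> h0 x0 fg.
have dF (y : R) : 0 < y ->
    is_derive y 1 (iter n (bdiff h) f) (- iter n (bdiff h) g y).
  by move=> y0; apply: is_derive_iter_bdiff => //; exact: ltW.
have xh : x < x + h by rewrite ltrDl.
have [||c /[!in_itv]/= /andP[xc _] e] :=
    @MVT R (iter n (bdiff h) f) (fun y => - iter n (bdiff h) g y) x (x + h) xh.
- by move=> y /[!in_itv]/= /andP[xy _]; apply: dF; exact: lt_trans xy.
- apply: derivable_within_continuous => y /[!in_itv]/= /andP[xy _].
  by have [] := dF y (lt_le_trans x0 xy).
- exists c => //; rewrite /= /bdiff -opprB e; ring.
Qed.

(** The functions k! / y^(k+1) form a chain, each being minus the derivative of the one before, so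
    every mean value step raises k by one. *)
Lemma iter_bdiff_inv_le (R : realType) (h : R) (n k : nat) (x : R) :
  0 < h -> 0 < x ->
  iter n (bdiff h) (fun y => k`!%:R / y ^+ k.+1) x <=
  h ^+ n * (n + k)`!%:R / x ^+ (n + k).+1.
Proof.
move=> h0 x0; elim: n k x x0 => [|n IHn] k x x0.
  by rewrite expr0 mul1r.
have [|c xc ->] := @iter_bdiff_MVT R h (fun y => k`!%:R / y ^+ k.+1)
    (fun y => k.+1`!%:R / y ^+ k.+2) n x h0 x0.
  move=> y y0.
  have d1 : is_derive y 1 (fun z : R => z ^+ k.+1) (k.+1%:R * y ^+ k).
    have := is_deriveX k.+1 (is_derive_id y (1 : R)).
    by rewrite exprfctE /GRing.scale /= mulr1.
  have yk : y ^+ k.+1 != 0 by rewrite expf_neq0 ?gt_eqF.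
  have d2 := is_deriveV (f := fun z : R => z ^+ k.+1) yk d1.
  apply: (is_derive_eq (is_deriveZ k`!%:R d2)).
  rewrite /= factS natrM /GRing.scale /= !exprS.
  have y0' : y != 0 by rewrite gt_eqF.
  by field; rewrite y0' expf_neq0.
have c0 := lt_trans x0 xc.
rewrite exprS -!mulrA ler_pM2l //.
apply: (le_trans (IHn _ _ c0)).
rewrite -mulrA ler_pM2l ?exprn_gt0 // addnS addSn ler_pM2l ?ltr0n ?fact_gt0 //.
by rewrite lef_pV2 ?posrE ?exprn_gt0 // lerXn2r ?nnegrE ?ltW.
Qed.

Lemma iter_bdiff_ln_le (R : realType) (h c : R) (n : nat) (x : R) :
  0 < h -> 0 < c -> 0 < x ->
  iter n.+1 (bdiff h) (fun y => - (ln y / c)) x <=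
  (h / x) ^+ n.+1 * n`!%:R / c.
Proof.
move=> h0 c0 x0.
have iterZ (m : nat) (f : R -> R) (y : R) :
    iter m (bdiff h) (fun z => f z / c) y = iter m (bdiff h) f y / c.
  elim: m y => [//|m IHm] y.
  by rewrite !iterS /bdiff -/(bdiff h) !IHm mulrBl.
under eq_fun do rewrite -mulNr.
rewrite iterZ ler_pM2r ?invr_gt0 //.
(* Minus the derivative of - ln y is 1 / y, the start k = 0 of the chain. *)
have [|d xd ->] := @iter_bdiff_MVT R h (fun y => - ln y)
    (fun y => 0`!%:R / y ^+ 1) n x h0 x0.
  by move=> y y0; rewrite mul1r; apply: is_deriveN; exact: is_derive1_ln.
have d0 := lt_trans x0 xd.
have := @iter_bdiff_inv_le R h n 0 d h0 d0; rewrite addn0.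
move=> bound.
apply: le_trans (_ : h * (h ^+ n * n`!%:R / d ^+ n.+1) <= _).
  by rewrite ler_pM2l.
rewrite exprMn exprVn (exprS h) -!mulrA ler_pM2l // ler_pM2l ?exprn_gt0 //.
rewrite mulrC ler_pM2r ?ltr0n ?fact_gt0 //.
by rewrite lef_pV2 ?posrE ?exprn_gt0 // lerXn2r ?nnegrE ?ltW.
Qed.

(** * A lower bound of Stirling type *)

(* [n ^ n * e ^ (- n) / (n - 1)!] is of order [sqrt n]. *)
Lemma stirling_weight_ge (R : realType) (n : nat) :
  n.+1%:R <= (expR 1 * (n.+1%:R ^+ n.+1 * expR (- n.+1%:R) / n`!%:R)) ^+ 4 :> R.
Proof.
have bern (m : nat) (t : R) : 0 <= t -> 1 + m%:R * t <= (1 + t) ^+ m.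
  move=> t0; elim: m => [|m IHm]; first by rewrite mul0r addr0.
  rewrite exprS -natr1.
  have /(ler_wpM2l (addr_ge0 ler01 t0)) := IHm.
  apply: le_trans.
  have : 0 <= t * (m%:R * t) by rewrite !mulr_ge0.
  by nra.
elim: n => [|n IHn].
  (* The factor [expR 1] normalises the weight to 1 at n = 0. *)
  by rewrite expr1 mul1r divr1 -expRD subrr expR0 expr1n.
set a := (X in X ^+ 4) in IHn; set b := (X in _ <= X ^+ 4).
set x : R := n.+1%:R in a b IHn *.
have x1 : 1 <= x by rewrite ler1n.
have x0 : 0 < x by rewrite (lt_le_trans _ x1).
have xS : n.+2%:R = x + 1 :> R by rewrite -natr1.
have xn0 : x != 0 by rewrite gt_eqF.
have x10 : x + 1 != 0 by rewrite gt_eqF ?addr_gt0.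
have f0 : 0 < n`!%:R :> R by rewrite ltr0n fact_gt0.
have fS : n.+1`!%:R = x * n`!%:R :> R by rewrite factS natrM.
clearbody x.
have a0 : 0 < a.
  by rewrite mulr_gt0 ?expR_gt0 // divr_gt0 // mulr_gt0 ?expR_gt0 ?exprn_gt0.
(* The ratio of consecutive weights is y^(n+2), where n + 2 = x + 1. *)
pose y : R := (x + 1) / x * expR (- (x + 1)^-1).
have bE : b = a * y ^+ n.+2.
  rewrite /a /b /y xS fS opprD expRD exprMn -expRM_natl mulrN xS.
  rewrite divff ?gt_eqF ?addr_gt0 // exprMn exprVn.
  rewrite (exprS x n.+1).
  by field; rewrite !gt_eqF ?exprn_gt0.
have yge : 1 + (4 * x * (x + 1))^-1 <= y.
  (* squaring [exp (- t / 2) >= 1 - t / 2] gives the second-order accuracy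
     that [exp (- t) >= 1 - t] lacks *)
  have e1 : (1 - (2 * (x + 1))^-1) ^+ 2 <= expR (- (x + 1)^-1).
    have -> : - (x + 1)^-1 = 2%:R * - (2 * (x + 1))^-1.
      by field; rewrite gt_eqF // addr_gt0.
    rewrite expRM_natl lerXn2r ?nnegrE ?expR_ge0 //; last exact: expR_ge1Dx.
    by rewrite subr_ge0 invf_le1; lra.
  rewrite /y -(@ler_pM2l _ (x / (x + 1))) ?divr_gt0 ?addr_gt0 //.
  rewrite [leRHS](_ : _ = expR (- (x + 1)^-1)); last first.
    by field; rewrite ?xn0 ?x10.
  apply: le_trans e1; rewrite le_eqVlt; apply/orP; left; apply/eqP.
  by field; rewrite ?xn0 ?x10.
have yn : 1 + (4 * x)^-1 <= y ^+ n.+2.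
  have t0 : 0 <= (4 * x * (x + 1))^-1.
    by rewrite invr_ge0 !mulr_ge0 ?addr_ge0 // ltW.
  apply: le_trans (_ : (1 + (4 * x * (x + 1))^-1) ^+ n.+2 <= _).
    apply: le_trans (bern n.+2 _ t0).
    rewrite xS le_eqVlt; apply/orP; left; apply/eqP.
    by field; rewrite ?xn0 ?x10.
  by rewrite lerXn2r ?nnegrE ?addr_ge0 // (le_trans _ yge) ?addr_ge0.
rewrite bE exprMn xS.
have z0 : 0 < (4 * x)^-1 by rewrite invr_gt0 mulr_gt0.
have zx : x * (4 * x)^-1 = 4^-1 by field; rewrite gt_eqF.
(* The fourth power turns the growth factor 1 + 1 / (4 x) into at least 1 + 1 / x, which carries x
   to x + 1. *)
have y4 : 1 + 4 * (4 * x)^-1 <= (y ^+ n.+2) ^+ 4.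
  apply: le_trans (bern 4%N _ (ltW z0)) _.
  by rewrite lerXn2r ?nnegrE ?addr_ge0 ?(ltW z0) // (le_trans _ yn) ?addr_ge0 ?(ltW z0).
apply: le_trans (ler_pM _ _ IHn y4); first by nra.
  exact: ltW.
by rewrite addr_ge0 // mulr_ge0 // ltW.
Qed.

(** * The mantissa law as a limit of window sums *)

Lemma prob_itv_standard_exponential (R : realType) (d : measure_display)
    (T : measurableType d) (P : probability T R) (X : {RV P >-> R}) (a b : R) :
  standard_exponential X -> 0 <= a -> a < b ->
  P [set t | a <= X t <= b] = (expR (- a) - expR (- b))%:E.
Proof.
move=> stdX a0 ab; rewrite stdX // ?ltW //.
have dE (x : R) : is_derive x 1 (fun y : R => - expR (- y)) (expR (- x)).
  have d1 : is_derive x 1 (-%R : R -> R) (- 1) by apply: is_deriveN.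
  have d2 : is_derive x 1 (expR \o -%R) (expR (- x) * - 1).
    exact: is_derive1_comp.
  by have := is_deriveN d2; rewrite mulrN1 opprK.
have cE (x : R) : {for x, continuous (fun y : R => - expR (- y))}.
  by apply: differentiable_continuous; apply/derivable1_diffP; have [] := dE x.
rewrite (@continuous_FTC2 R _ (fun y : R => - expR (- y))) //.
- by rewrite -EFinB opprK addrC.
- apply: continuous_subspaceT => x.
  apply: (continuous_comp (f := -%R)); first exact: opp_continuous.
  exact: continuous_expR.
- split.
  + by move=> x _; have [] := dE x.
  + exact: cvg_at_right_filter (cE a).
  + exact: cvg_at_left_filter (cE b).
- by move=> x _; rewrite derive1E; have [] := dE x.
Qed.

(* Minus the probability that the mantissa of a standard exponential variable
   lies in [1, s] and its exponent in [- N, N). *)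
Definition exp_window (R : realType) (B : R) (N : nat) (s : R) : R :=
  \sum_(i < N.*2) (expR (- (s * B ^ (i%:Z - N%:Z))) - expR (- B ^ (i%:Z - N%:Z))).

(** Continuity of [P] from below: the mantissa event is the increasing union of the events [A N]
    that restrict the exponent to [- N, N). *)
Lemma benford_cvg_exp_window (R : realType) (d : measure_display)
    (T : measurableType d) (P : probability T R) (X : {RV P >-> R}) (B s : R) :
  standard_exponential X -> 1 < B -> benford B X -> 1 <= s < B ->
  exp_window B N s @[N --> \oo] --> - (ln s / ln B).
Proof.
move=> stdX B1 benX /andP[s1 sB].
have B0 : 0 < B by apply: lt_trans B1.
(* At s = 1 the intervals degenerate to points, and all terms of the window vanish. *)
have [->|s1'] := eqVneq s 1.
  rewrite ln1 mul0r oppr0.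
  rewrite (_ : exp_window B ^~ 1 = fun=> 0); first exact: cvg_cst.
  apply/funext => N; apply: big1 => i _.
  by rewrite mul1r subrr.
have {s1'} lt1s : 1 < s by rewrite lt_neqAle eq_sym s1'.
pose E (k : int) : set T := [set t | B ^ k <= X t <= s * B ^ k].
have mE k : measurable (E k).
  rewrite (_ : E k = X @^-1` `[B ^ k, s * B ^ k]).
    by apply: measurable_funPTI; exact: measurable_itv.
  by apply/seteqP; split=> t /=; rewrite in_itv.
have PE k : P (E k) = (expR (- B ^ k) - expR (- (s * B ^ k)))%:E.
  apply: prob_itv_standard_exponential => //; first exact/ltW/exprz_gt0.
  by rewrite ltr_pMl // exprz_gt0.
have mantE k t : E k t -> is_mantissa B (X t) (X t * B ^ (- k)).
  have Bk0 : 0 < B ^ k by exact: exprz_gt0.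
  move=> /andP[h1 h2]; split.
    rewrite -invr_expz ler_pdivlMr // mul1r h1 /= ltr_pdivrMr //.
    by rewrite (le_lt_trans h2) // ltr_pM2r.
  by exists k; rewrite -invr_expz divfK // gt_eqF.
(* Disjointness: uniqueness of the mantissa forces equal powers of B. *)
have Einj k l t : E k t -> E l t -> k = l.
  move=> Ek El.
  have X0 : 0 < X t by move: Ek => /andP[+ _]; apply: lt_le_trans; exact: exprz_gt0.
  have := is_mantissa_uniq B1 (mantE _ _ Ek) (mantE _ _ El).
  have Bn1 : B != 1 by rewrite gt_eqF.
  by move=> /(mulfI (lt0r_neq0 X0))/(ieexprIz B0 Bn1)/oppr_inj.
pose A N : set T := \big[setU/set0]_(i < N.*2) E (i%:Z - N%:Z).
have AP N t : A N t <-> exists2 i, (i < N.*2)%N & E (i%:Z - N%:Z) t.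
  rewrite /A -(bigcup_mkord N.*2 (fun i => E (i%:Z - N%:Z))).
  by split=> [[i ? ?]|[i ? ?]]; exists i.
have PA N : P (A N) = (- exp_window B N s)%:E.
  rewrite /A (measure_bigsetU P (F := fun i => E (i%:Z - N%:Z))) //.
    rewrite /exp_window -sumrN -sumEFin.
    by apply: eq_bigr => i _; rewrite opprB; exact: PE.
  move=> i j _ _ [t [Ei Ej]].
  by have /addIr[] := Einj _ _ _ Ei Ej.
have UA : \bigcup_N A N = [set t | 1 <= mantissa B (X t) <= s].
  apply/seteqP; split=> t.
    move=> [N _ /AP[i _ Et]].
    set k := _ - _ in Et.
    have Bk0 : 0 < B ^ k by exact: exprz_gt0.
    move: (Et) => /andP[h1 h2].
    have X0 : 0 < X t by exact: lt_le_trans h1.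
    rewrite /=; have <- := (mantissaP _ B1 X0).1 (mantE _ _ Et).
    by rewrite -invr_expz ler_pdivlMr // mul1r h1 ler_pdivrMr.
  move=> /= /andP[h1 h2].
  have X0 : 0 < X t.
    by rewrite ltNge; apply/negP => /(mantissa_le0 B1) m0; move: h1; rewrite m0 ler10.
  have [_ [k Xk]] := (mantissaP _ B1 X0).2 erefl.
  have Bk0 : 0 < B ^ k by exact: exprz_gt0.
  (* N = |k| + 1 ensures - N <= k < N; the index of k is then k + N. *)
  exists (absz k).+1 => //; apply/AP.
  exists (absz (k + (absz k).+1%:Z)); first by lia.
  rewrite [X in E X](_ : _ = k); last by lia.
  by rewrite /E /= Xk ler_peMl ?ler_pM2r // ltW.
have ndA : {homo A : n m / (n <= m)%N >-> (n <= m)%O}.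
  move=> n m nm; apply/subsetPset => t /AP[i i_n Et].
  apply/AP; exists (i + (m - n))%N; first by lia.
  by rewrite [X in E X](_ : _ = i%:Z - n%:Z) //; lia.
have mA N : measurable (A N) by apply: bigsetU_measurable.
have := nondecreasing_cvg_mu (mu := P) mA (bigcup_measurable (fun n _ => mA n)) ndA.
rewrite [X in _ --> X -> _](_ : _ = (ln s / ln B)%:E); last first.
  by rewrite UA; apply: benX; rewrite s1 ltW.
rewrite [X in X @ _ --> _ -> _](_ : _ = EFin \o (fun N => - exp_window B N s));
  last by apply/funext => N; exact: PA.
move/fine_cvgP => [_ /cvgN].
by apply: cvg_trans; apply: near_eq_cvg; near=> N; rewrite /= opprK.
Unshelve. all: end_near. Qed.

(** * Extension of the limit to all positive s *)

(** Multiplying s by B shifts the exponents by one, so the difference of the two sums telescopes to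
    its end terms. *)
Lemma exp_windowM (R : realType) (B : R) (N : nat) (s : R) : 0 < B ->
  exp_window B N (B * s) =
  exp_window B N s + (expR (- (s * B ^+ N)) - expR (- (s * B^-1 ^+ N))).
Proof.
move=> B0; apply/eqP; rewrite addrC -subr_eq -sumrB; apply/eqP.
pose u (i : nat) := expR (- (s * B ^ (i%:Z - N%:Z))).
transitivity (\sum_(0 <= i < N.*2) (u i.+1 - u i)).
  rewrite big_mkord; apply: eq_bigr => i _.
  rewrite opprB addrA subrK /u intS -addrA (expfzDr 1) ?gt_eqF // expr1z.
  by rewrite (mulrCA s) -mulrA.
rewrite telescope_sumr // /u -addnn PoszD addrK sub0r exprVn.
by rewrite -exprnP -exprnN.
Qed.

(** The end terms tend to 0 - 1, matching the change of - log_B under s -> B s. The limits at s and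
    at B s are thus equivalent, and s = m B^k is reached from its mantissa m by induction on k in
    both directions. *)
Lemma cvg_exp_window (R : realType) (B : R) : 1 < B ->
  (forall s, 1 <= s < B -> exp_window B N s @[N --> \oo] --> - (ln s / ln B)) ->
  forall s, 0 < s -> exp_window B N s @[N --> \oo] --> - (ln s / ln B).
Proof.
move=> B1 cvg1B s s0.
have B0 : 0 < B by apply: lt_trans B1.
have lB : ln B != 0 by rewrite gt_eqF ?ln_gt0.
have V0 : (B^-1 ^+ N) @[N --> \oo] --> (0 : R).
  by apply: cvg_expr; rewrite ger0_norm ?invr_ge0 ?ltW // invf_lt1.
have shift (x : R) : 0 < x ->
    expR (- (x * B ^+ N)) - expR (- (x * B^-1 ^+ N)) @[N --> \oo] --> - (1 : R).
  move=> x0; rewrite -[X in _ --> X]add0r; apply: cvgB; last first.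
    rewrite -[X in _ --> X]expR0.
    apply: (@continuous_cvg _ _ _ _ _ (fun N => - (x * B^-1 ^+ N)) expR 0).
      exact: continuous_expR.
    by rewrite -oppr0; apply: cvgN; rewrite -(mulr0 x); apply: cvgMr.
  (* The upper bound is e^(- y) <= 1 / y at y = x B^N. *)
  apply: (@squeeze_cvgr _ _ _ _ (fun=> 0) (fun N => x^-1 * B^-1 ^+ N)).
  - near=> N; rewrite expR_ge0 /= expRN exprVn -invfM.
    rewrite lef_pV2 ?posrE ?expR_gt0 ?mulr_gt0 ?exprn_gt0 //.
    by rewrite (le_trans _ (expR_ge1Dx _)) // lerDr.
  - exact: cvg_cst.
  - by rewrite -(mulr0 x^-1); apply: cvgMr.
have up (x : R) : 0 < x ->
    exp_window B N x @[N --> \oo] --> - (ln x / ln B) <->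
    exp_window B N (B * x) @[N --> \oo] --> - (ln (B * x) / ln B).
  move=> x0.
  have -> : - (ln (B * x) / ln B) = - (ln x / ln B) + - 1.
    by rewrite lnM ?posrE //; field.
  split=> [cx|cx].
    rewrite (_ : exp_window B ^~ (B * x) = fun N => exp_window B N x +
      (expR (- (x * B ^+ N)) - expR (- (x * B^-1 ^+ N)))).
      exact: cvgD cx (shift _ x0).
    by apply/funext => N; exact: exp_windowM.
  rewrite (_ : exp_window B ^~ x = fun N => exp_window B N (B * x) -
      (expR (- (x * B ^+ N)) - expR (- (x * B^-1 ^+ N)))).
    by rewrite -[X in _ --> X](addrK (- 1)); exact: cvgB cx (shift _ x0).
  by apply/funext => N; rewrite exp_windowM // addrK.
have [m1B [k sk]] := is_mantissa_ex B1 s0.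
set m := s * _ in m1B sk; rewrite {1 2}sk.
have m0 : 0 < m by have /andP[m1 _] := m1B; exact: lt_le_trans m1.
have mpos (i : int) : 0 < m * B ^ i by rewrite mulr_gt0 ?exprz_gt0.
have mB (i : int) : m * B ^ (1 + i) = B * (m * B ^ i).
  by rewrite expfzDr ?gt_eqF // expr1z; ring.
elim: k {sk} => [|n IHn|n IHn].
- by rewrite expr0z mulr1; exact: cvg1B.
- by rewrite intS mB; exact: (up _ (mpos n)).1.
- apply: (up _ (mpos _)).2.
  by rewrite -mB intS opprD addNKr.
Unshelve. all: end_near. Qed.

(** * Comparison of differences and contradiction *)

(** All terms contribute nonnegatively; the one kept has index i = N, hence exponent 0. The bound
    does not depend on N, so it survives the limit. *)
Lemma iter_bdiff_exp_window_ge (R : realType) (B h s : R) (n N : nat) :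
  0 < B -> 0 <= h -> (0 < N)%N ->
  expR (- s) * (1 - expR (- h)) ^+ n.+1 <=
  iter n.+1 (bdiff h) (exp_window B N) s.
Proof.
move=> B0 h0 N0.
have N2 : (N < N.*2)%N by lia.
rewrite iter_bdiff_sum (bigD1 (Ordinal N2)) // -[X in X <= _]addr0.
apply: lerD.
  by rewrite iter_bdiff_expR subrr expr0z !mulr1.
apply: sumr_ge0 => i _.
rewrite iter_bdiff_expR mulr_ge0 ?expR_ge0 // exprn_ge0 //.
rewrite subr_ge0 -expR0 ler_expR oppr_le0 mulr_ge0 //.
exact/ltW/exprz_gt0.
Qed.

Theorem corollaryA2 (R : realType) (d : measure_display) (T : measurableType d)
    (P : probability T R) (zeta : {RV P >-> R}) :
  standard_exponential zeta -> ~ exists B : R, 1 < B /\ benford B zeta.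
Proof.
move=> stdX [B [B1 benX]].
have B0 : 0 < B by apply: lt_trans B1.
have lB : 0 < ln B by rewrite ln_gt0.
have cvgW (s : R) : 0 < s ->
    exp_window B N s @[N --> \oo] --> - (ln s / ln B).
  by apply: cvg_exp_window => // u; exact: benford_cvg_exp_window stdX B1 benX.
pose C := expR 1 * (expR 1 / ln B).
suff bound (n : nat) : n.+1%:R <= C ^+ 4.
  have := bound (Num.truncn (C ^+ 4)).
  by apply/negP; rewrite -ltNge; apply: truncnS_gt.
apply: le_trans (stirling_weight_ge R n) _.
have e0 := expR_gt0 (1 : R).
set s : R := n.+1%:R.
have s0 : 0 < s by rewrite ltr0n.
have f0 : 0 < n`!%:R :> R by rewrite ltr0n fact_gt0.
have a0 : 0 < s ^+ n.+1 * expR (- s) / n`!%:R.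
  by rewrite divr_gt0 // mulr_gt0 ?expR_gt0 ?exprn_gt0.
have C0 : 0 < C by rewrite mulr_gt0 ?divr_gt0.
rewrite lerXn2r ?nnegrE ?(ltW C0) ?(ltW (mulr_gt0 e0 a0)) // ler_pM2l //.
(* With (n + 1) h = 1 the factor e^(- h) to the power n + 1 is the constant e^(-1). *)
pose h := s^-1.
have h0 : 0 < h by rewrite invr_gt0.
have diff_le : expR (- s) * (1 - expR (- h)) ^+ n.+1 <=
    (h / s) ^+ n.+1 * n`!%:R / ln B.
  apply: le_trans (iter_bdiff_ln_le n h0 lB s0).
  have c := cvg_iter_bdiff (n := n.+1) (ltW h0) s0 cvgW.
  rewrite -(cvg_lim _ c) //; apply: limr_ge; first by apply/cvg_ex; eexists; exact: c.
  by exists 1%N => // N N0; apply: iter_bdiff_exp_window_ge; rewrite ?ltW.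
have eh : h ^+ n.+1 * expR (- 1) <= (1 - expR (- h)) ^+ n.+1.
  have -> : expR (- 1) = expR (- h) ^+ n.+1.
    by rewrite -expRM_natl mulrN divff ?gt_eqF.
  have he0 : 0 <= h * expR (- h) by rewrite mulr_ge0 ?expR_ge0 // ltW.
  (* This is 1 + h <= e^h multiplied by e^(- h). *)
  have he1 : h * expR (- h) <= 1 - expR (- h).
    have := expR_ge1Dx h; rewrite -(ler_pM2r (expR_gt0 (- h))) -expRD subrr.
    by rewrite expR0 mulrDl mul1r -lerBrDl.
  by rewrite -exprMn lerXn2r ?nnegrE // (le_trans he0).
clearbody s h.
have := le_trans (ler_wpM2l (expR_ge0 (- s)) eh) diff_le.
rewrite (expRN 1) exprMn exprVn => main.
have hn : 0 < h ^+ n.+1 by rewrite exprn_gt0.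
have sn : 0 < s ^+ n.+1 by rewrite exprn_gt0.
(* Multiplying by e s^(n+1) / (h^(n+1) n!) leaves the weight on the left and e / ln B on the
   right. *)
have {main} := ler_wpM2l (ltW (divr_gt0 (mulr_gt0 e0 sn) (mulr_gt0 hn f0))) main.
by congr (_ <= _); field; rewrite !gt_eqF.
Qed.
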